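(* For every integer $n\ge 0$ there is a set $\mathrm{Paths}_n$ of centered paths, whose vertices are elements of $\mathrm{RV}^+_{n;2}$, such that the vertex sets $V(P)$, $P\in\mathrm{Paths}_n$, are pairwise disjoint with union $\mathrm{RV}^+_{n;2}$, and for every $P\in\mathrm{Paths}_n$: (i) $\mathrm{rad}(P)\equiv 0\pmod 2$; (ii) if $P(j)=T$ then $\mathrm{ind}(T)=j$; (iii) if $T\in V(P)$ then $\mathrm{rad}(P)=\mathrm{rad}(T)$.
   Context: Centered path: for an integer $r\ge 0$, a centered path $P$ of radius $\mathrm{rad}(P)=r$ consists of $r+1$ distinct vertices indexed $P(-r),P(-r+2),\dots,P(r-2),P(r)$ with directed edges $P(-r+2i)\to P(-r+2i+2)$ for $0\le i<r$; $V(P)$ is its vertex set. $\tau(i)=|i+1|-1$. For integers $r_1,r_2\ge 0$ and $x,y$: $\rho(r_1,r_2,x,y)=r_1+y$ if $y\ge -x+r_2-r_1$, and $\rho(r_1,r_2,x,y)=r_2-x$ if $y<-x+r_2-r_1$. Radius-value trees: a height-$0$ tree is a single vertex labeled by an even integer (its value). A height-$(n+1)$ tree is $T=(l,T_1,T_2,T_3)$ with $l$ even, $T_i$ radius-value trees of height $n$, and $|l-\mathrm{val}(T_1)-\mathrm{val}(T_3)|\le\tau(\mathrm{val}(T_2))$; $\mathrm{val}(T)=l$. $\mathrm{RV}_{n;2}$ is the set of height-$n$ trees all of whose leaves are labeled $2$. For $T\in\mathrm{RV}_{n;2}$, $\mathrm{ind}(T)=\mathrm{val}(T)-2^{n+1}$.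 The radius: $\mathrm{rad}(T)=0$ for height $0$; for trees $T_1,T_3$ put $\mathrm{rad}(T_1,T_3)=\rho(\mathrm{rad}(T_1),\mathrm{rad}(T_3),\mathrm{ind}(T_1),\mathrm{ind}(T_3))$, and for $T=(l,T_1,T_2,T_3)$ with $j=l-\mathrm{val}(T_1)-\mathrm{val}(T_3)$, $\mathrm{rad}(T)=\rho(\mathrm{rad}(T_1,T_3),\tau(\mathrm{val}(T_2)),\mathrm{ind}(T_1)+\mathrm{ind}(T_3),j)$. Define $\mathrm{RV}^+_{0;2}=\mathrm{RV}_{0;2}$ and, for $n\ge1$, $\mathrm{RV}^+_{n;2}$ is the set of $T=(l,T_1,T_2,T_3)\in\mathrm{RV}_{n;2}$ with $T_1,T_2,T_3\in\mathrm{RV}^+_{n-1;2}$ and $\mathrm{val}(T_2)\ge\max(\mathrm{rad}(T_2)-2^n,0)$. *)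

(* Defs.v *)
From HB Require Import structures.
From mathcomp Require Import all_boot all_order all_algebra.
From mathcomp Require Import boolp classical_sets.

Set Implicit Arguments.
Unset Strict Implicit.
Unset Printing Implicit Defensive.

Import Order.TTheory GRing.Theory Num.Theory.

Local Open Scope classical_set_scope.
Local Open Scope ring_scope.

(* The vertex of index -r + 2i is [cpt i]; the edges are determined by the
   indexing, see [cpath_edge]. *)
Record cpath (V : Type) := CPath {
  crad : nat;
  cpt : 'I_crad.+1 -> V;
  cpt_inj : injective cpt
}.

Definition cpath_verts (V : Type) (P : cpath V) : set V := range (@cpt V P).

(* P(j) = v; no vertex has index j unless |j| <= crad P and j = crad P mod 2. *)
Definition cpath_at (V : Type) (P : cpath V) (j : int) (v : V) : Prop :=
  exists i : 'I_(crad P).+1,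
    j = - (crad P)%:Z + 2 * (i : nat)%:Z /\ cpt i = v.

Definition cpath_edge (V : Type) (P : cpath V) (u v : V) : Prop :=
  exists j : int, cpath_at P j u /\ cpath_at P (j + 2) v.

Definition rv_tau (i : int) : int := `|i + 1| - 1.

Definition rv_rho (r1 r2 x y : int) : int :=
  if - x + r2 - r1 <= y then r1 + y else r2 - x.

(* Raw labeled ternary trees; the conditions making them radius-value trees
   are imposed by [is_rvtree]. *)
Inductive rvraw : Type :=
| Leaf of int
| Node of int & rvraw & rvraw & rvraw.

Definition rv_val (T : rvraw) : int :=
  match T with Leaf l => l | Node l _ _ _ => l end.

(* Meaningful on trees satisfying [is_rvtree n] for some n, where all branches
   have the same length. *)
Fixpoint rv_height (T : rvraw) : nat :=
  match T with Leaf _ => 0%N | Node _ T1 _ _ => (rv_height T1).+1 end.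

Fixpoint is_rvtree (n : nat) (T : rvraw) : Prop :=
  match n, T with
  | 0%N, Leaf l => (2 %| l)%Z
  | m.+1, Node l T1 T2 T3 =>
      [/\ (2 %| l)%Z, is_rvtree m T1, is_rvtree m T2, is_rvtree m T3 &
          `|l - rv_val T1 - rv_val T3| <= rv_tau (rv_val T2)]
  | _, _ => False
  end.

Fixpoint leaves_eq (a : int) (T : rvraw) : Prop :=
  match T with
  | Leaf l => l = a
  | Node _ T1 T2 T3 => [/\ leaves_eq a T1, leaves_eq a T2 & leaves_eq a T3]
  end.

Definition RV2 (n : nat) : set rvraw :=
  [set T | is_rvtree n T /\ leaves_eq 2 T].

Definition rv_ind (T : rvraw) : int := rv_val T - 2 ^+ (rv_height T).+1.

Fixpoint rv_rad (T : rvraw) : int :=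
  match T with
  | Leaf _ => 0
  | Node l T1 T2 T3 =>
      let rad13 := rv_rho (rv_rad T1) (rv_rad T3) (rv_ind T1) (rv_ind T3) in
      rv_rho rad13 (rv_tau (rv_val T2)) (rv_ind T1 + rv_ind T3) (l - rv_val T1 - rv_val T3)
  end.

Fixpoint RV2plus (n : nat) : set rvraw :=
  match n with
  | 0%N => RV2 0
  | m.+1 => [set T | RV2 m.+1 T /\
      exists l T1 T2 T3,
        [/\ T = Node l T1 T2 T3, RV2plus m T1, RV2plus m T2, RV2plus m T3 &
            Num.max (rv_rad T2 - 2 ^+ m.+1) 0 <= rv_val T2]]
  end.

(* Main.v *)
Require Import Defs.
From HB Require Import structures.
From mathcomp Require Import all_boot all_order all_algebra.
From mathcomp Require Import boolp classical_sets.
From mathcomp Require Import zify.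

Set Implicit Arguments.
Unset Strict Implicit.
Unset Printing Implicit Defensive.

Import Order.TTheory GRing.Theory Num.Theory.

Local Open Scope classical_set_scope.
Local Open Scope ring_scope.

                                                                              
                                                                              
                                                                             
                                                                                 
                                                                          
                                                                              
                                                                            
                                                                                
                                                                              
                                                     

(** The trees form an analogue of an sl2-crystal: a set graded by an even index and an even radius,
    with mutually inverse partial operators moving the index by 2 and keeping the radius. Such a set
    splits into strings, each running through the indices -rad, ..., rad, and the strings are the
    required paths ([crystal_paths]). Since [rv_rho r1 r2 x y] is the maximum of [r1 + y] and
    [r2 - x], it is the radius given by the tensor product rule, so crystals are closed under
    products ([crystal_prod]). A tree of height n+1 amounts to a pair (T1, T3) together with a
    middle tree T2 and an even defect j = l - val T1 - val T3 in the interval [-val T2, val T2].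
    Index and radius match this decomposition, so induction on the height concludes
    ([crystal_RV2plus]). *)

Definition is_graded (V : Type) (S : set V) (ind rad : V -> int) : Prop :=
  forall v, S v -> [/\ (2 %| ind v)%Z, (2 %| rad v)%Z & `|ind v| <= rad v].

(** The operators are total functions, constrained only away from the top (for [f]) or the bottom
    (for [g]) of a string; their values at the ends are arbitrary. *)
Definition is_raising (V : Type) (S : set V) (ind rad : V -> int)
    (f g : V -> V) : Prop :=
  forall v, S v -> ind v < rad v ->
    [/\ S (f v), ind (f v) = ind v + 2, rad (f v) = rad v & g (f v) = v].

Definition is_lowering (V : Type) (S : set V) (ind rad : V -> int)
    (f g : V -> V) : Prop :=
  forall v, S v -> - rad v < ind v ->
    [/\ S (g v), ind (g v) = ind v - 2, rad (g v) = rad v & f (g v) = v].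

Definition is_crystal (V : Type) (S : set V) (ind rad : V -> int) : Prop :=
  is_graded S ind rad /\
  exists f g, is_raising S ind rad f g /\ is_lowering S ind rad f g.

(** * Decomposition of a crystal into strings *)

Section Strings.

Variables (V : Type) (S : set V) (ind rad : V -> int) (f g : V -> V).
Hypothesis gradedS : is_graded S ind rad.
Hypothesis raisef : is_raising S ind rad f g.
Hypothesis lowerg : is_lowering S ind rad f g.

Lemma iter_raising (k : nat) (v : V) : S v -> ind v + 2 * k%:Z <= rad v ->
  [/\ S (iter k f v), ind (iter k f v) = ind v + 2 * k%:Z,
      rad (iter k f v) = rad v & iter k g (iter k f v) = v].
Proof.
move=> Sv; elim: k => [|k IHk] hk; first by split=> //=; lia.
have [|S1 i1 r1 c1] := IHk; first by lia.
have [|S2 i2 r2 c2] := raisef S1; first by lia.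
by split; rewrite ?iterS // ?i2 ?r2 //; [lia | rewrite -iterS iterSr /= c2].
Qed.

Lemma iter_lowering (k : nat) (v : V) : S v -> - rad v <= ind v - 2 * k%:Z ->
  [/\ S (iter k g v), ind (iter k g v) = ind v - 2 * k%:Z,
      rad (iter k g v) = rad v & iter k f (iter k g v) = v].
Proof.
move=> Sv; elim: k => [|k IHk] hk; first by split=> //=; lia.
have [|S1 i1 r1 c1] := IHk; first by lia.
have [|S2 i2 r2 c2] := lowerg S1; first by lia.
by split; rewrite ?iterS // ?i2 ?r2 //; [lia | rewrite -iterS iterSr /= c2].
Qed.

(** A string is described by its bottom vertex [v], from which the path is obtained by repeated
    raising. *)
Definition string_from (v : V) (P : cpath V) : Prop :=
  [/\ S v, ind v = - rad v, (crad P)%:Z = rad v &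
      forall i, cpt (c := P) i = iter i f v].

Lemma string_fromP (v : V) (P : cpath V) (i : 'I_(crad P).+1) :
  string_from v P ->
  [/\ S (cpt i), ind (cpt i) = - (crad P)%:Z + 2 * (i : nat)%:Z,
      rad (cpt i) = (crad P)%:Z & iter i g (cpt i) = v].
Proof.
case=> Sv iv rP ->.
have [|S1 i1 r1 c1] := iter_raising (k := i) Sv; first by have := ltn_ord i; lia.
by split=> //; rewrite ?i1 ?iv -?rP ?r1.
Qed.

Lemma string_from_uniq (v : V) (P Q : cpath V) :
  string_from v P -> string_from v Q -> P = Q.
Proof.
case: P Q => [r p pI] [s q qI] [_ _ /= rP pE] [_ _ /= rQ qE].
have rs : r = s by lia.
subst s; have pq : p = q by apply/funext => i; rewrite pE qE.
by subst q; congr CPath; apply: Prop_irrelevance.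
Qed.

Lemma string_from_exists (v : V) : S v -> ind v = - rad v ->
  exists P, string_from v P.
Proof.
move=> Sv iv; have [_ _ rv] := gradedS Sv.
have rE : (`|rad v|%N)%:Z = rad v by lia.
(* Distinct iterates have distinct indices, [ind v + 2 * i]. *)
have inj : injective (fun i : 'I_(`|rad v|%N).+1 => iter i f v).
  move=> i j ij; apply/val_inj => /=.
  have [|_ i1 _ _] := iter_raising (k := i) Sv; first by have := ltn_ord i; lia.
  have [|_ j1 _ _] := iter_raising (k := j) Sv; first by have := ltn_ord j; lia.
  by move: i1; rewrite ij j1; lia.
by exists (CPath inj).
Qed.

Lemma string_through (v : V) : S v ->
  exists w P, string_from w P /\ cpath_verts P v.
Proof.
move=> Sv; have [iv rv le] := gradedS Sv.
(* The number of lowerings from [v] down to index [- rad v]; it is also the position of [v] in its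
   string. *)
pose k := `|(ind v + rad v) %/ 2|%Z%N.
have kE : 2 * k%:Z = ind v + rad v by rewrite /k; lia.
have [|S1 i1 r1 c1] := iter_lowering (k := k) Sv; first by lia.
have [|P sP] := string_from_exists S1; first by lia.
exists (iter k g v), P; split=> //.
have kP : (k < (crad P).+1)%N by case: sP => _ _; rewrite r1; lia.
by exists (Ordinal kP) => //; case: sP => _ _ _ ->.
Qed.

(** A common vertex determines everything: its radius is that of both paths, its index then fixes
    its position, and lowering it that many times yields the bottom vertex of both. *)
Lemma string_from_meet (v w : V) (P Q : cpath V) :
  string_from v P -> string_from w Q ->
  cpath_verts P `&` cpath_verts Q !=set0 -> P = Q.
Proof.
move=> sP sQ [u [[i _ iu] [j _ ju]]].
have [_ + + ci] := string_fromP i sP; have [_ + + cj] := string_fromP j sQ.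
rewrite iu ju => iE rE jE sE.
have ij : i = j :> nat by lia.
have vw : v = w by rewrite -ci -cj iu ju ij.
by rewrite vw in sP; exact: string_from_uniq sP sQ.
Qed.

End Strings.

Lemma crystal_paths (V : Type) (S : set V) (ind rad : V -> int) :
  is_crystal S ind rad ->
  exists Paths : set (cpath V),
    [/\ trivIset Paths (@cpath_verts V),
        \bigcup_(P in Paths) cpath_verts P = S &
        forall P : cpath V, Paths P ->
          [/\ crad P = 0 %[mod 2],
              forall (j : int) (v : V), cpath_at P j v -> ind v = j &
              forall v : V, cpath_verts P v -> (crad P)%:Z = rad v]].
Proof.
case=> grS [f [g [raisef lowerg]]].
exists [set P | exists v, string_from S ind rad f v P]; split.
- move=> P Q [v sP] [w sQ]; exact: (string_from_meet raisef sP sQ).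
- apply/seteqP; split=> [v [P [w sP] [i _ <-]]|v Sv].
    by have [] := string_fromP raisef i sP.
  have [w [P [sP Pv]]] := string_through grS raisef lowerg Sv.
  by exists P => //; exists w.
- move=> P [v sP]; split.
  + by case: (sP) => Sv _ rP _; have [_ rv _] := grS _ Sv; lia.
  + by move=> j w [i [-> <-]]; have [_ ->] := string_fromP raisef i sP.
  + by move=> w [i _ <-]; have [_ _ ->] := string_fromP raisef i sP.
Qed.

(** * Constructions of crystals: transport, product, intervals *)

Lemma crystal_transfer (V W : Type) (S : set V) (S' : set W)
    (ind rad : V -> int) (ind' rad' : W -> int) (phi : V -> W) (psi : W -> V) :
  (forall v, S v -> [/\ S' (phi v), psi (phi v) = v,
                        ind' (phi v) = ind v & rad' (phi v) = rad v]) ->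
  (forall w, S' w -> S (psi w) /\ phi (psi w) = w) ->
  is_crystal S' ind' rad' -> is_crystal S ind rad.
Proof.
move=> hphi hpsi [grS' [f [g [raisef lowerg]]]]; split.
  by move=> v /hphi [Sv _ <- <-]; exact: grS'.
exists (psi \o f \o phi), (psi \o g \o phi); split=> v /hphi [Sv pv iv rv] h /=.
- have [|S1 i1 r1 c1] := raisef _ Sv; first by rewrite iv rv.
  have [S2 p2] := hpsi _ S1; have [_ _ i2 r2] := hphi _ S2.
  by split; rewrite // -?i2 -?r2 p2 ?i1 ?r1 ?iv ?rv // c1.
- have [|S1 i1 r1 c1] := lowerg _ Sv; first by rewrite iv rv.
  have [S2 p2] := hpsi _ S1; have [_ _ i2 r2] := hphi _ S2.
  by split; rewrite // -?i2 -?r2 p2 ?i1 ?r1 ?iv ?rv // c1.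
Qed.

Definition prod_ind (V W : Type) (ind1 : V -> int) (ind2 : W -> int)
    (u : V * W) : int := ind1 u.1 + ind2 u.2.

Definition prod_rad (V W : Type) (ind1 rad1 : V -> int) (ind2 rad2 : W -> int)
    (u : V * W) : int :=
  rv_rho (rad1 u.1) (rad2 u.2) (ind1 u.1) (ind2 u.2).

                                                                               
                                                                             
                                 
(** Tensor product rule: each operator moves the factor that does not enter the current maximum in
    [rv_rho]. Where [rad1 + ind2] is the larger term the first factor moves, otherwise the second,
    so the radius is preserved. *)
Lemma crystal_prod (V W : Type) (S1 : set V) (S2 : set W)
    (ind1 rad1 : V -> int) (ind2 rad2 : W -> int) :
  is_crystal S1 ind1 rad1 -> is_crystal S2 ind2 rad2 ->
  is_crystal (S1 `*` S2) (prod_ind ind1 ind2) (prod_rad ind1 rad1 ind2 rad2).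
Proof.
case=> gr1 [f1 [g1 [raise1 lower1]]] [gr2 [f2 [g2 [raise2 lower2]]]]; split.
  case=> v w [/= /gr1 [? ? ?] /gr2 [? ? ?]].
  rewrite /prod_ind /prod_rad /rv_rho /=.
  by case: ifPn => ?; split; lia.
pose f (u : V * W) :=
  if rad2 u.2 - rad1 u.1 <= ind1 u.1 + ind2 u.2
  then (f1 u.1, u.2) else (u.1, f2 u.2).
(* The test is strict here but not in [f]: raising the second factor may land exactly on the
   boundary, and lowering must then undo it there. The two formulas for the radius agree on the
   boundary. *)
pose g (u : V * W) :=
  if rad2 u.2 - rad1 u.1 < ind1 u.1 + ind2 u.2
  then (g1 u.1, u.2) else (u.1, g2 u.2).
exists f, g; split=> -[v w] [/= Sv Sw];
  have [ev rv lv] := gr1 _ Sv; have [ew rw lw] := gr2 _ Sw;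
  rewrite /prod_ind /prod_rad /rv_rho /=.
- rewrite /f /=; case: (leP (rad2 w - rad1 v)) => c h.
    have [|Sf i1 r1 c1] := raise1 _ Sv; first by move: h; case: ifPn => ?; lia.
    split; rewrite /= ?i1 ?r1 //; [lia | by do 2 case: ifPn => ?; lia |].
    by rewrite /g /= i1 r1 ifT ?c1 //; lia.
  have [|Sf i1 r1 c1] := raise2 _ Sw; first by lia.
  split; rewrite /= ?i1 ?r1 //; [lia | by do 2 case: ifPn => ?; lia |].
  by rewrite /g /= i1 r1 ifF ?c1 //; lia.
- rewrite /g /=; case: (ltP (rad2 w - rad1 v)) => c h.
    have [|Sg i1 r1 c1] := lower1 _ Sv; first by lia.
    split; rewrite /= ?i1 ?r1 //; [lia | by do 2 case: ifPn => ?; lia |].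
    by rewrite /f /= i1 r1 ifT ?c1 //; lia.
  have [|Sg i1 r1 c1] := lower2 _ Sw; first by move: h; case: ifPn => ?; lia.
  split; rewrite /= ?i1 ?r1 //; [lia | by do 2 case: ifPn => ?; lia |].
  by rewrite /f /= i1 r1 ifF ?c1 //; lia.
Qed.

(** Each [v] contributes a single string, the even integers of [-r v, r v]. *)
Lemma crystal_intervals (V : Type) (S : set V) (r : V -> int) :
  (forall v, S v -> (2 %| r v)%Z) ->
  is_crystal [set u : V * int | [/\ S u.1, (2 %| u.2)%Z & `|u.2| <= r u.1]]
    snd (r \o fst).
Proof.
move=> er; split; first by case=> v j [/= /er].
exists (fun u => (u.1, u.2 + 2)), (fun u => (u.1, u.2 - 2)).
split=> -[v j] [/= Sv ej lj] h; have := er _ Sv.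
- by split=> //=; [split=> //=; lia | congr pair; lia].
- by split=> //=; [split=> //=; lia | congr pair; lia].
Qed.

(** * The crystal of radius-value trees *)

Lemma rvtree_height (n : nat) (T : rvraw) : is_rvtree n T -> rv_height T = n.
Proof.
elim: n T => [|n IHn] [l|l T1 T2 T3] //=.
by case=> _ /IHn ->.
Qed.

Lemma rvtree_even (n : nat) (T : rvraw) : is_rvtree n T -> (2 %| rv_val T)%Z.
Proof. by case: n T => [|n] [l|l T1 T2 T3] //= []. Qed.

Lemma RV2plus_RV2 (n : nat) (T : rvraw) : RV2plus n T -> RV2 n T.
Proof. by case: n => [|n] // []. Qed.

Lemma RV2plus_ind (n : nat) (T : rvraw) :
  RV2plus n T -> rv_ind T = rv_val T - 2 ^+ n.+1.
Proof. by move=> /RV2plus_RV2 [/rvtree_height hT _]; rewrite /rv_ind hT. Qed.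

Lemma rv_tau_ge0 (i : int) : 0 <= i -> rv_tau i = i.
Proof. by rewrite /rv_tau; lia. Qed.

Definition RV2mid (n : nat) : set rvraw :=
  [set T | RV2plus n T /\ Num.max (rv_rad T - 2 ^+ n.+1) 0 <= rv_val T].

(** The condition on T2 forces [0 <= rv_val T2], where [rv_tau] is the identity. The three subtrees
    then vary independently, and the bound on the defect depends on T2 alone. *)
Lemma RV2plusS (n : nat) (l : int) (T1 T2 T3 : rvraw) :
  RV2plus n.+1 (Node l T1 T2 T3) <->
  [/\ RV2plus n T1, RV2mid n T2, RV2plus n T3, (2 %| l)%Z &
      `|l - rv_val T1 - rv_val T3| <= rv_val T2].
Proof.
split=> [[[[el _ _ _ le] _] [l' [U1 [U2 [U3]]]]] | [p1 [p2 m2] p3 el le]].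
  case=> -[? ? ? ?] p1 p2 p3 m2; subst l' U1 U2 U3.
  by split=> //; rewrite -[rv_val T2]rv_tau_ge0 //; lia.
have [t1 l1] := RV2plus_RV2 p1; have [t2 l2] := RV2plus_RV2 p2.
have [t3 l3] := RV2plus_RV2 p3.
split; last by exists l, T1, T2, T3.
by split=> //=; split=> //; rewrite rv_tau_ge0 //; lia.
Qed.

(** The grouping follows the nesting of [rv_rho] in [rv_rad]. The [Leaf] value is a dummy. *)
Definition rv_split (T : rvraw) : (rvraw * rvraw) * (rvraw * int) :=
  match T with
  | Leaf _ => ((T, T), (T, 0))
  | Node l T1 T2 T3 => ((T1, T3), (T2, l - rv_val T1 - rv_val T3))
  end.

Definition rv_join (u : (rvraw * rvraw) * (rvraw * int)) : rvraw :=
  Node (u.2.2 + rv_val u.1.1 + rv_val u.1.2) u.1.1 u.2.1 u.1.2.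

Lemma crystal_RV2plus (n : nat) : is_crystal (RV2plus n) rv_ind rv_rad.
Proof.
elim: n => [|n IHn].
  (* At height 0 there is one tree, of index and radius 0, so the conditions on the operators are
     vacuous. *)
  have RV0 T : RV2plus 0 T -> T = Leaf 2.
    by case: T => [l|l T1 T2 T3] [] //= _ ->.
  split; first by move=> T /RV0 ->.
  by exists id, id; split=> T /RV0 ->.
have mid_even T : RV2mid n T -> (2 %| rv_val T)%Z.
  by case=> /RV2plus_RV2 [/rvtree_even].
have C := crystal_prod (crystal_prod IHn IHn) (crystal_intervals mid_even).
apply: (crystal_transfer (phi := rv_split) (psi := rv_join) _ _ C).
- case=> [l|l T1 T2 T3] hT; first by case: hT => -[].
  have iT := RV2plus_ind hT; case/RV2plusS: hT => p1 m2 p3 el le.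
  have [t1 _] := RV2plus_RV2 p1; have [t3 _] := RV2plus_RV2 p3.
  have e1 := rvtree_even t1; have e3 := rvtree_even t3.
  split.
  + by split=> //; split=> //=; lia.
  + by rewrite /rv_join /=; congr Node; lia.
  (* The index is additive because the shift doubles with the height: 2^(n+2) is the sum of the
     shifts of T1 and T3. *)
  + rewrite /prod_ind /= iT (RV2plus_ind p1) (RV2plus_ind p3) /=.
    by rewrite (exprS (2 : int) n.+1); lia.
  + by rewrite /prod_rad /prod_ind /= rv_tau_ge0 //; lia.
- case=> -[T1 T3] [T2 j] [[/= p1 p3] [/= m2 ej lj]].
  have [t1 _] := RV2plus_RV2 p1; have [t3 _] := RV2plus_RV2 p3.
  have e1 := rvtree_even t1; have e3 := rvtree_even t3.
  split; last by rewrite /rv_join /=; congr (_, (_, _)); lia.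
  by apply/RV2plusS; split=> //=; lia.
Qed.

Theorem theorem5p3 (n : nat) :
  exists Paths : set (cpath rvraw),
    [/\ trivIset Paths (@cpath_verts rvraw),
        \bigcup_(P in Paths) cpath_verts P = RV2plus n &
        forall P : cpath rvraw, Paths P ->
          [/\ crad P = 0 %[mod 2],
              forall (j : int) (T : rvraw), cpath_at P j T -> rv_ind T = j &
              forall T : rvraw, cpath_verts P T -> (crad P)%:Z = rv_rad T]].
Proof. exact: crystal_paths (crystal_RV2plus n). Qed.
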